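(* Let $\alpha,\beta>0$ and let $d\ge 2$ be an integer. Let $c=(c_0,\dots,c_{d-1})\in\mathbb{R}^d$ with $c_0=0$ and $c_i=\alpha$ for $i\neq 0$. Let $P=\{x\in\mathbb{R}^d:\sum_i x_i=\beta,\ x\ge 0\}$, let $\Delta,R_1,R_H$ be the suboptimality gap, $\ell_1$ radius and entropic radius of $P$ (with objective $c^\top x$), and for $\eta>0$ let $x^\eta$ be the optimal solution of the entropy-penalized program over $P$. If $\eta\ge\frac{1+\log d}{\alpha}=\frac{R_1+R_H}{\Delta}$, then $$c^\top x^\eta\ \ge\ \frac19\,\alpha\beta\, e^{-\eta\alpha+1+\log d}\ =\ \frac19\,\Delta\exp\Big(-\eta\frac{\Delta}{R_1}+\frac{R_1+R_H}{R_1}\Big).$$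
   Context: For a nonnegative vector $x$, $H(x)=\sum_i x_i\log\frac1{x_i}$ (natural logarithm, $0\log\frac10=0$). $x^\eta$ is the (unique) minimizer of $c^\top x-\eta^{-1}H(x)$ over $x\in P$. Coordinates are indexed by $0,1,\dots,d-1$. Let $V$ be the set of vertices of $P$ and $v^*\in\operatorname{argmin}_{v\in V}c^\top v$; then $\Delta=\min\{c^\top(v-v^* ):v\in V,\ c^\top v>c^\top v^*\}$, $R_1=\max_{x\in P}\|x\|_1$, $R_H=\max_{x,y\in P}(H(x)-H(y))$. For this polytope $\Delta=\alpha\beta$, $R_1=\beta$, $R_H=\beta\log d$, and $\min_{x\in P}c^\top x=0$. *)

(* Defs.v *)
From mathcomp Require Import all_boot all_order all_algebra.
From mathcomp Require Import all_classical all_reals all_analysis.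

Set Implicit Arguments.
Unset Strict Implicit.
Unset Printing Implicit Defensive.

Import Order.TTheory GRing.Theory Num.Theory.
Local Open Scope classical_set_scope.
Local Open Scope ring_scope.

Section optimization.
Context {R : realType}.
Implicit Type A : set R.

(* Attained extrema (not just [sup] and [inf]); the value is 0 by convention
   when the extremum is not attained. *)
Definition set_max A : R := xget 0 [set m | A m /\ ubound A m].
Definition set_min A : R := xget 0 [set m | A m /\ lbound A m].

Definition argmin (T : Type) (S : set T) (f : T -> R) : set T :=
  [set x | S x /\ forall y, S y -> f x <= f y].

End optimization.

Section linear_program.
Context {R : realType} {d : nat}.
Implicit Types (c x v : 'cV[R]_d) (P : set 'cV[R]_d) (eta : R).

Definition dotp c x : R := (c^T *m x) ord0 ord0.

Definition norm1 x : R := \sum_i `|x i ord0|.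

(* A product with 0 vanishes and [ln] and [^-1] are total, so the convention
   0 log (1/0) = 0 needs no case distinction. *)
Definition entropy x : R := \sum_i x i ord0 * ln ((x i ord0)^-1).

(* The vertices of a polyhedron are its extreme points: points that are not in
   the relative interior of a nondegenerate segment contained in P. *)
Definition vertices P : set 'cV[R]_d :=
  [set v | P v /\ forall x y (t : R), P x -> P y -> 0 < t < 1 ->
     v = t *: x + (1 - t) *: y -> x = v /\ y = v].

(* Only the value [dotp c vstar] matters, so the choice of the minimizing
   vertex [vstar] made by [xget] is immaterial. *)
Definition gap c P : R :=
  let vstar := xget 0 (argmin (vertices P) (dotp c)) in
  set_min [set dotp c (v - vstar) |
           v in [set v | vertices P v /\ dotp c vstar < dotp c v]].

Definition l1_radius P : R := set_max [set norm1 x | x in P].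

Definition entropic_radius P : R :=
  set_max [set entropy x - entropy y | x in P & y in P].

Definition penalized_opt c P eta : 'cV[R]_d :=
  xget 0 (argmin P (fun x => dotp c x - eta^-1 * entropy x)).

End linear_program.

Definition scaled_simplex {R : realType} (d : nat) (beta : R) : set 'cV[R]_d :=
  [set x : 'cV[R]_d | \sum_i x i ord0 = beta /\ forall i, 0 <= x i ord0].

Definition simplex_cost {R : realType} (d : nat) (alpha : R) : 'cV[R]_d :=
  \col_(i < d) (if val i == 0%N then 0 else alpha).

Arguments scaled_simplex {R} d beta.
Arguments simplex_cost {R} d alpha.

(* Main.v *)
(* Over the simplex, the penalized objective is, up to an affine rescaling, the
   relative entropy with respect to the Gibbs point
   [q_i = beta * exp (- eta * c_i) / Z], so Gibbs' inequality and its equality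
   case make [q] the unique minimizer. Its cost is
   [alpha * beta * (d - 1) * r / (1 + (d - 1) * r)] with
   [r = exp (- eta * alpha)], and the assumption on [eta] says [e * d * r <= 1].
   Gibbs' inequality against the uniform point also gives the entropic radius. *)
Require Import Defs.
From mathcomp Require Import all_boot all_order all_algebra.
From mathcomp Require Import all_classical all_reals all_analysis.
From mathcomp Require Import ring lra.
Import Order.TTheory GRing.Theory Num.Theory.

Local Open Scope classical_set_scope.
Local Open Scope ring_scope.

(** * Attained extrema and the linear cost *)

Lemma set_max_eq {R : realType} (A : set R) (m : R) :
  A m -> ubound A m -> set_max A = m.
Proof.
move=> Am Um; apply: xget_unique; first by split.
by move=> y [Ay Uy]; apply/le_anti; rewrite Um // Uy.
Qed.

Lemma set_min_eq {R : realType} (A : set R) (m : R) :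
  A m -> lbound A m -> set_min A = m.
Proof.
move=> Am Lm; apply: xget_unique; first by split.
by move=> y [Ay Ly]; apply/le_anti; rewrite Lm // Ly.
Qed.

Lemma dotpE {R : realType} {d : nat} (c x : 'cV[R]_d) :
  dotp c x = \sum_i c i ord0 * x i ord0.
Proof. by rewrite /dotp mxE; apply: eq_bigr => i _; rewrite mxE. Qed.

Lemma dotpB {R : realType} {d : nat} (c x y : 'cV[R]_d) :
  dotp c (x - y) = dotp c x - dotp c y.
Proof. by rewrite /dotp mulmxBr !mxE. Qed.

(** * Gibbs' inequality with its equality case *)

Section gibbs_inequality.
Context {R : realType}.

(** For [x > 0], dividing by [x] turns this into [ln y <= y - 1] at [y = q / x]; for [x = 0] it
    reads [0 <= q]. *)
Lemma gibbs_term (x q : R) : 0 <= x -> 0 < q ->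
  x * ln x^-1 + x * ln q <= q - x ?= iff (x == q).
Proof.
rewrite le_eqVlt => /orP[/eqP <- q_gt0|x_gt0 q_gt0].
  rewrite !mul0r addr0 subr0; split; first exact: ltW.
  by rewrite eq_sym.
have qx_gt0 : 0 < q / x by rewrite divr_gt0.
have lnqx : ln x^-1 + ln q = ln (q / x).
  by rewrite ln_div ?posrE // lnV ?posrE // addrC.
have qxE : q - x = x * (q / x - 1) by field; rewrite gt_eqF.
rewrite -mulrDr lnqx qxE; split.
  rewrite ler_pM2l // -[X in ln X](subrK 1) addrC le_ln1Dx //.
  by rewrite ltrBDl subrr.
have x0 : x != 0 by rewrite gt_eqF.
apply/eqP/eqP => [/(mulfI x0) lnE|->]; last by rewrite divff ?gt_eqF // ln1 subrr.
(* Equality means [ln (q / x) = q / x - 1]. A nonzero logarithm would contradict the strict bound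
   [1 + y < expR y] at [y = ln (q / x)]. *)
have [l0|/expR_gt1Dx] := eqVneq (ln (q / x)) 0.
  by move: lnE; rewrite l0 => /esym/eqP; rewrite subr_eq0 => /eqP /divr1_eq.
by rewrite lnK ?posrE // lnE addrC subrK ltxx.
Qed.

(** Sum [gibbs_term] over the coordinates: the right-hand sides cancel because the totals agree, and
    equality of the sums forces equality in every term. *)
Lemma gibbs_inequality (d : nat) (x q : 'cV[R]_d) :
  (forall i, 0 <= x i ord0) -> (forall i, 0 < q i ord0) ->
  \sum_i x i ord0 = \sum_i q i ord0 ->
  entropy x <= - \sum_i x i ord0 * ln (q i ord0) ?= iff (x == q).
Proof.
move=> x_ge0 q_gt0 sumE.
have [le_sum eq_sum] := leif_sum (fun i (_ : true) => gibbs_term _ _ (x_ge0 i) (q_gt0 i)).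
move: le_sum eq_sum; rewrite big_split sumrB /= -sumE subrr -/(entropy x) => le_sum eq_sum.
split; first by rewrite -subr_le0 opprK.
rewrite -subr_eq0 opprK eq_sum; apply/forallP/eqP => [xq|-> i]; last by rewrite eqxx.
by apply/colP => i; apply/eqP/xq.
Qed.

End gibbs_inequality.

(** * The Gibbs point solves the penalized program *)

Section gibbs_point.
Context {R : realType} {d : nat}.
Implicit Types (c : 'cV[R]_d.+1) (beta eta : R).

(** The dimension is a successor so that the sum is nonempty, hence positive and a legitimate
    divisor. *)
Definition partition_fun c eta : R := \sum_i expR (- (eta * c i ord0)).

Definition gibbs_point c beta eta : 'cV[R]_d.+1 :=
  \col_i (beta / partition_fun c eta * expR (- (eta * c i ord0))).

Lemma partition_fun_gt0 c eta : 0 < partition_fun c eta.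
Proof.
rewrite /partition_fun big_ord_recl ltr_pwDl ?expR_gt0 //.
by apply: sumr_ge0 => i _; exact: expR_ge0.
Qed.

Lemma gibbs_point_gt0 c beta eta i : 0 < beta -> 0 < gibbs_point c beta eta i ord0.
Proof. by move=> b0; rewrite mxE mulr_gt0 ?expR_gt0 ?divr_gt0 ?partition_fun_gt0. Qed.

Lemma gibbs_point_in c beta eta : 0 < beta ->
  scaled_simplex d.+1 beta (gibbs_point c beta eta).
Proof.
move=> b0; split=> [|i]; last exact/ltW/gibbs_point_gt0.
under eq_bigr do rewrite mxE.
by rewrite -mulr_sumr divfK // gt_eqF // partition_fun_gt0.
Qed.

Lemma penalized_opt_simplex c beta eta : 0 < beta -> 0 < eta ->
  penalized_opt c (scaled_simplex d.+1 beta) eta = gibbs_point c beta eta.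
Proof.
move=> b0 e0; set q := gibbs_point c beta eta.
have q_gt0 i : 0 < q i ord0 by exact: gibbs_point_gt0.
have Pq : scaled_simplex d.+1 beta q by exact: gibbs_point_in.
pose L := ln (beta / partition_fun c eta); pose K := beta * L.
(* Since [ln q_i = L - eta * c_i] and the total of [x] is [beta], the objective is a constant plus
   [eta^-1] times the defect in Gibbs' inequality. *)
have objE x : scaled_simplex d.+1 beta x -> dotp c x - eta^-1 * entropy x =
    eta^-1 * (K + (- (\sum_i x i ord0 * ln (q i ord0)) - entropy x)).
  move=> [sumx _]; rewrite addrA mulrBr; congr (_ - _).
  rewrite /K -sumx mulr_suml -sumrB mulr_sumr dotpE; apply: eq_bigr => i _.
  have -> : ln (q i ord0) = L - eta * c i ord0.
    by rewrite /L mxE lnM ?posrE ?expR_gt0 ?divr_gt0 ?partition_fun_gt0 ?expRK.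
  by field; rewrite gt_eqF.
have gibbs x : scaled_simplex d.+1 beta x ->
    entropy x <= - \sum_i x i ord0 * ln (q i ord0) ?= iff (x == q).
  by move=> [sx x0]; apply: gibbs_inequality => //; rewrite sx (proj1 Pq).
have objq : dotp c q - eta^-1 * entropy q = eta^-1 * K.
  rewrite objE //; have /eqP <- : entropy q == - \sum_i q i ord0 * ln (q i ord0).
    by rewrite (gibbs q Pq).2.
  by rewrite subrr addr0.
apply: xget_unique.
  split=> // y Py; rewrite objq objE // ler_pM2l ?invr_gt0 // lerDl subr_ge0.
  exact: (gibbs y Py).1.
(* Comparing another minimizer with [q] makes its defect nonpositive, so the equality case
   identifies it with [q]. *)
move=> x [Px] /(_ q Pq); rewrite objq objE // ler_pM2l ?invr_gt0 //.
rewrite gerDl subr_le0 => le_x; apply/eqP; rewrite -(gibbs x Px).2.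
by rewrite eq_le le_x (gibbs x Px).1.
Qed.

End gibbs_point.

(** * The scaled simplex: vertices, radii and gap *)

Section simplex.
Context {R : realType} {d : nat}.
Implicit Types (beta alpha : R) (x v : 'cV[R]_d) (j : 'I_d).

Lemma delta_colE beta j i :
  (beta *: delta_mx j ord0 : 'cV[R]_d) i ord0 = if i == j then beta else 0.
Proof. by rewrite !mxE eqxx andbT; case: eqP; rewrite ?mulr1 ?mulr0. Qed.

(** A general [f] serves both the total ([f] the identity) and the entropy ([f z = z * ln z^-1]) of
    a vertex. *)
Lemma sum_delta_col beta j (f : R -> R) : f 0 = 0 ->
  \sum_i f ((beta *: delta_mx j ord0 : 'cV[R]_d) i ord0) = f beta.
Proof.
move=> f0; rewrite (bigD1 j) //= big1 ?addr0 ?delta_colE ?eqxx // => i /negPf ij.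
by rewrite delta_colE ij.
Qed.

Lemma simplex_delta beta j : 0 < beta ->
  scaled_simplex d beta (beta *: delta_mx j ord0).
Proof.
move=> b0; split; first exact: (sum_delta_col beta j id).
by move=> i; rewrite delta_colE; case: eqP => // _; exact: ltW.
Qed.

Lemma simplex_le beta x i : scaled_simplex d beta x -> x i ord0 <= beta.
Proof.
move=> [<- x0]; rewrite (bigD1 i) //= lerDl.
by apply: sumr_ge0.
Qed.

Lemma simplex_delta_eq beta j x : scaled_simplex d beta x ->
  (forall i, i != j -> x i ord0 = 0) -> x = beta *: delta_mx j ord0.
Proof.
move=> [sx _] x0; apply/colP => i; rewrite delta_colE.
have [->|/x0 //] := eqVneq i j.
by rewrite -sx (bigD1 j) //= big1 ?addr0.
Qed.

(** If a scaled unit vector is a strict convex combination, its zero coordinates vanish at both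
    endpoints, which pins them down. Conversely, an extreme point with a positive coordinate [j]
    either has all its mass there or splits off a multiple of the unit vector. *)
Lemma vertices_simplex beta v : 0 < beta ->
  vertices (scaled_simplex d beta) v <-> exists j, v = beta *: delta_mx j ord0.
Proof.
move=> b0; split=> [[Pv ext]|[j ->]]; last first.
  split; first exact: simplex_delta.
  move=> x y t Px Py /andP[t0 t1] E.
  have z i : i != j -> x i ord0 = 0 /\ y i ord0 = 0.
    move=> /negPf ij; move/colP/(_ i): E; rewrite delta_colE ij !mxE => E.
    have x0 := Px.2 i; have y0 := Py.2 i.
    have s0 : 0 < 1 - t by rewrite subr_gt0.
    have /eqP : t * x i ord0 + (1 - t) * y i ord0 = 0 by [].
    rewrite paddr_eq0 ?mulr_ge0 // 1?ltW // !mulf_eq0 (gt_eqF t0) (gt_eqF s0) /=.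
    by move=> /andP[/eqP -> /eqP ->].
  by split; apply: simplex_delta_eq => // i /z[].
have [j vj] : exists j, 0 < v j ord0.
  apply: contrapT => nv; have : \sum_i v i ord0 = beta := Pv.1.
  rewrite big1 => [b|i _]; first by move: b0; rewrite -b ltxx.
  apply/eqP; rewrite eq_le Pv.2 andbT leNgt; apply/negP => vi.
  by apply: nv; exists i.
exists j; have [vjE|vjN] := eqVneq (v j ord0) beta.
  apply: simplex_delta_eq => // i ij; apply/eqP; rewrite eq_le Pv.2 andbT.
  have := Pv.1; rewrite (bigD1 j) //= (bigD1 i) //= vjE => s.
  have : 0 <= \sum_(k < d | (k != j) && (k != i)) v k ord0.
    by apply: sumr_ge0 => k _; exact: Pv.2.
  by lra.
have vjlt : v j ord0 < beta by rewrite lt_neqAle vjN simplex_le.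
(* This weight removes exactly coordinate [j] from [v], so the rescaled remainder [y] stays
   nonnegative and has total [beta]. *)
pose t := v j ord0 / beta.
have t0 : 0 < t by rewrite divr_gt0.
have t1 : t < 1 by rewrite ltr_pdivrMr // mul1r.
have s0 : 0 < 1 - t by rewrite subr_gt0.
pose y := (1 - t)^-1 *: (v - t *: (beta *: delta_mx j ord0)).
have yE i : y i ord0 = (1 - t)^-1 * (v i ord0 - t * (if i == j then beta else 0)).
  by rewrite -delta_colE !mxE.
have Py : scaled_simplex d beta y.
  split=> [|i].
    under eq_bigr do rewrite yE -delta_colE.
    rewrite -mulr_sumr sumrB -mulr_sumr Pv.1 (sum_delta_col beta j id) //.
    by field; rewrite gt_eqF.
  rewrite yE mulr_ge0 ?invr_ge0 ?(ltW s0) //; case: eqP => [->|_].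
    by rewrite /t divfK ?subrr ?gt_eqF.
  by rewrite mulr0 subr0 Pv.2.
have vE : v = t *: (beta *: delta_mx j ord0) + (1 - t) *: y.
  by rewrite /y (scalerA (1 - t)) mulfV ?gt_eqF // scale1r addrC subrK.
have t01 : 0 < t < 1 by rewrite t0.
by have [-> _] := ext _ y t (simplex_delta _ j b0) Py t01 vE.
Qed.

Lemma l1_radius_simplex beta : (0 < d)%N -> 0 < beta ->
  l1_radius (scaled_simplex d beta) = beta.
Proof.
move=> d0 b0.
have norm1E x : scaled_simplex d beta x -> norm1 x = beta.
  by move=> [<- x0]; apply: eq_bigr => i _; rewrite ger0_norm.
apply: set_max_eq => [|_ [x Px <-]]; last by rewrite norm1E.
by exists (beta *: delta_mx (Ordinal d0) ord0); [|apply: norm1E]; exact: simplex_delta.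
Qed.

(** The maximum is at the uniform point [u], the minimum at a vertex [w]. The minimum is
    [- beta * ln beta] rather than 0, because the total mass is [beta]; this term cancels in the
    difference. *)
Lemma entropic_radius_simplex beta : (0 < d)%N -> 0 < beta ->
  entropic_radius (scaled_simplex d beta) = beta * ln d%:R.
Proof.
move=> d0 b0.
have dR : 0 < d%:R :> R by rewrite ltr0n.
have bd0 : 0 < beta / d%:R by rewrite divr_gt0.
pose u : 'cV[R]_d := const_mx (beta / d%:R).
pose w : 'cV[R]_d := beta *: delta_mx (Ordinal d0) ord0.
have uE i : u i ord0 = beta / d%:R by rewrite mxE.
have sumu : \sum_i u i ord0 = beta.
  under eq_bigr do rewrite uE.
  by rewrite sumr_const card_ord -[LHS]mulr_natr divfK // gt_eqF.
have Pu : scaled_simplex d beta u by split=> // i; rewrite uE ltW.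
have le_u x : scaled_simplex d beta x ->
    entropy x <= beta * (ln d%:R - ln beta) ?= iff (x == u).
  move=> [sx x0].
  have := gibbs_inequality _ x u x0 (fun i => _) (etrans sx (esym sumu)).
  under eq_bigr do rewrite uE.
  rewrite -mulr_suml sx ln_div ?posrE // -mulrN opprB; apply=> i.
  by rewrite uE.
have Hw : entropy w = beta * - ln beta.
  by rewrite -lnV ?posrE //; apply: (sum_delta_col beta _ (fun z => z * ln z^-1)); rewrite mul0r.
(* Every coordinate is at most [beta], so each [ln] factor in the entropy of [x] is at least
   [- ln beta]. *)
have ge_w x : scaled_simplex d beta x -> beta * - ln beta <= entropy x.
  move=> Px; rewrite -[X in X * _](Px.1) mulr_suml; apply: ler_sum => i _.
  have := Px.2 i; rewrite le_eqVlt => /orP[/eqP <-|xi]; first by rewrite !mul0r.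
  by rewrite ler_pM2l // lnV ?posrE // lerN2 ler_ln ?posrE // simplex_le.
apply: set_max_eq.
  exists u => //; exists w; first exact: simplex_delta.
  have /eqP -> : entropy u == beta * (ln d%:R - ln beta) by rewrite (le_u u Pu).2.
  by rewrite Hw; ring.
move=> _ [x Px [y Py <-]].
have -> : beta * ln d%:R = beta * (ln d%:R - ln beta) - beta * - ln beta by ring.
by apply: lerB; [exact: (le_u x Px).1|exact: ge_w].
Qed.

Lemma dotp_delta (c : 'cV[R]_d) beta j :
  dotp c (beta *: delta_mx j ord0) = c j ord0 * beta.
Proof.
rewrite dotpE (bigD1 j) //= delta_colE eqxx big1 ?addr0 // => i /negPf ij.
by rewrite delta_colE ij mulr0.
Qed.

Lemma gap_simplex alpha beta : (2 <= d)%N -> 0 < alpha -> 0 < beta ->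
  gap (simplex_cost d alpha) (scaled_simplex d beta) = alpha * beta.
Proof.
move=> d2 a0 b0; set c := simplex_cost d alpha; set P := scaled_simplex d beta.
pose i0 := Ordinal (ltnW d2); pose i1 := Ordinal d2.
have c_ge0 i : 0 <= c i ord0 by rewrite mxE; case: ifP => // _; exact: ltW.
have c0 : dotp c (beta *: delta_mx i0 ord0) = 0 by rewrite dotp_delta mxE /= mul0r.
have V j : vertices P (beta *: delta_mx j ord0) by apply/vertices_simplex => //; exists j.
have dotp_ge0 v : vertices P v -> 0 <= dotp c v.
  by move=> /vertices_simplex[] // j ->; rewrite dotp_delta mulr_ge0 // ltW.
rewrite /gap; set vs := xget _ _.
(* A minimizing vertex must be exhibited for [xget] not to fall back on its default; the vertex at
   index 0 has cost 0, and no vertex has negative cost. *)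
have [Vvs minvs] : argmin (vertices P) (dotp c) vs.
  apply: xgetPex; exists (beta *: delta_mx i0 ord0); split=> // y Vy.
  by rewrite c0 dotp_ge0.
have vs0 : dotp c vs = 0.
  by apply/le_anti; rewrite -{1}c0 minvs // dotp_ge0.
apply: set_min_eq.
  exists (beta *: delta_mx i1 ord0); last by rewrite dotpB vs0 subr0 dotp_delta mxE.
  by split=> //; rewrite vs0 dotp_delta mxE /= mulr_gt0.
move=> _ [v [/vertices_simplex[] // j -> +] <-].
rewrite dotpB vs0 subr0 dotp_delta mxE; case: ifP => // _.
by rewrite mul0r ltxx.
Qed.

End simplex.

(** * Cost of the Gibbs point and the final estimate *)

Lemma dotp_gibbs_point {R : realType} (n : nat) (alpha beta eta : R) :
  let r := expR (- (eta * alpha)) in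
  dotp (simplex_cost n.+1 alpha) (gibbs_point (simplex_cost n.+1 alpha) beta eta) =
  alpha * beta * (n%:R * r) / (1 + n%:R * r).
Proof.
move=> r; rewrite dotpE big_ord_recl [simplex_cost _ _ _ _]mxE mul0r add0r.
have ZE : partition_fun (simplex_cost n.+1 alpha) eta = 1 + n%:R * r.
  rewrite /partition_fun big_ord_recl !mxE /= mulr0 oppr0 expR0.
  under eq_bigr do rewrite mxE /=.
  by rewrite sumr_const card_ord mulr_natl.
under eq_bigr do rewrite !mxE /= ZE -/r.
by rewrite sumr_const card_ord -[LHS]mulr_natl; ring.
Qed.

(** The tangent bound gives [3 / 4 <= expR (- (1 / 4))]; its fourth power yields
    [expR 1 <= 256 / 81], which is below [7 / 2]. *)
Lemma expR1_le_7half {R : realType} : expR 1 <= 7 / 2 :> R.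
Proof.
have e4 : expR 1 * expR (- (1 / 4)) ^+ 4 = 1 :> R.
  rewrite -expRM_natl -expRD -[RHS]expR0; congr expR; lra.
have q_ge : 3 / 4 <= expR (- (1 / 4)) :> R.
  by apply: le_trans (expR_ge1Dx _); lra.
have q4_ge : (3 / 4) ^+ 4 <= expR (- (1 / 4)) ^+ 4 :> R.
  by apply: lerXn2r; rewrite // nnegrE; lra.
have : expR 1 * (3 / 4) ^+ 4 <= 1 :> R.
  by rewrite -[leRHS]e4 ler_pM2l ?expR_gt0.
lra.
Qed.

Theorem proposition4 (R : realType) (alpha beta : R) (d : nat)
    (alpha_gt0 : 0 < alpha) (beta_gt0 : 0 < beta) (d_ge2 : (2 <= d)%N) :
  let c := simplex_cost d alpha in
  let P := scaled_simplex d beta in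
  let Delta := gap c P in
  let R1 := l1_radius P in
  let RH := entropic_radius P in
  (1 + ln (d%:R : R)) / alpha = (R1 + RH) / Delta /\
  forall eta : R, 0 < eta -> (1 + ln (d%:R : R)) / alpha <= eta ->
    let xeta := penalized_opt c P eta in
    1 / 9 * (alpha * beta) * expR (- (eta * alpha) + 1 + ln (d%:R : R))
      <= dotp c xeta /\
    1 / 9 * (alpha * beta) * expR (- (eta * alpha) + 1 + ln (d%:R : R))
      = 1 / 9 * Delta * expR (- (eta * (Delta / R1)) + (R1 + RH) / R1).
Proof.
have d_gt0 : (0 < d)%N by exact: ltnW.
have dR_gt0 : 0 < d%:R :> R by rewrite ltr0n.
rewrite /= gap_simplex // l1_radius_simplex // entropic_radius_simplex //.
split=> [|eta eta_gt0 eta_ge].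
  by field; rewrite !gt_eqF.
split; last first.
  congr (_ * expR _).
  by field; rewrite gt_eqF.
case: d d_ge2 {d_gt0} dR_gt0 eta_ge => // n n_ge1 d_gt0 eta_ge.
rewrite penalized_opt_simplex // dotp_gibbs_point.
rewrite -addrA expRD expRD lnK ?posrE //.
(* The three factors combine into the exponential of [- eta * alpha + 1 + ln d], an exponent that
   the lower bound on [eta] makes nonpositive. *)
have re_le1 : expR (- (eta * alpha)) * (expR 1 * n.+1%:R) <= 1.
  rewrite -[X in _ * (_ * X)]lnK ?posrE // -!expRD -[X in _ <= X]expR0 ler_expR.
  by move: eta_ge; rewrite ler_pdivrMr //; lra.
set r := expR (- (eta * alpha)) in re_le1 *; set m : R := n%:R.
have r_gt0 : 0 < r by exact: expR_gt0.
have m_ge1 : 1 <= m by rewrite ler1n.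
rewrite -[n.+1%:R]natr1 -/m in re_le1 *.
set e : R := expR 1 in re_le1 *.
have e_gt0 : 0 < e by exact: expR_gt0.
have e_le : e <= 7 / 2 by exact: expR1_le_7half.
have Z_gt0 : 0 < 1 + m * r by nra.
rewrite ler_pdivlMr //.
have ab_gt0 : 0 < alpha * beta by rewrite mulr_gt0.
have re_gt0 : 0 < r * e by rewrite mulr_gt0.
(* With [d = m + 1 <= 2 m] and [e * m * r <= 1], the claim reduces to [2 (e + 1) <= 9]. *)
have eZ_le : e * (1 + m * r) <= 9 / 2 by lra.
have main : (m + 1) * (e * (1 + m * r)) <= 9 * m.
  apply: (@le_trans _ _ ((m + 1) * (9 / 2))); last by lra.
  by rewrite ler_pM2l //; lra.
(* Both sides share the positive factor [alpha * beta * r / 9]; cancelling it leaves [main]. *)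
have -> : 1 / 9 * (alpha * beta) * (r * (e * (m + 1))) * (1 + m * r) =
    alpha * beta * r / 9 * ((m + 1) * (e * (1 + m * r))) by field.
have -> : alpha * beta * (m * r) = alpha * beta * r / 9 * (9 * m) by field.
by rewrite ler_pM2l // divr_gt0 // mulr_gt0.
Qed.
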